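(* Let $s,m\ge 1$ be integers, $\boldsymbol{M},\boldsymbol{K}\in\mathbb{R}^{m\times m}$, $\boldsymbol{A}\in\mathbb{R}^{s\times s}$ and $\delta t>0$, and suppose that $\boldsymbol{\mathcal{A}}=\boldsymbol{I}_s\otimes\boldsymbol{M}+\delta t\,\boldsymbol{A}\otimes\boldsymbol{K}\in\mathbb{R}^{sm\times sm}$ is nonsingular. Let $\boldsymbol{A}=\boldsymbol{U}\boldsymbol{T}\boldsymbol{U}^{H}$ be any complex Schur decomposition of $\boldsymbol{A}$, where $\boldsymbol{U}\in\mathbb{C}^{s\times s}$ is unitary and $\boldsymbol{T}\in\mathbb{C}^{s\times s}$ is upper triangular, and define $$\boldsymbol{\mathcal{M}}_{\text{BCSD}}=(\boldsymbol{U}\otimes\boldsymbol{I}_m)\,\boldsymbol{\mathcal{T}}\,(\boldsymbol{U}^{H}\otimes\boldsymbol{I}_m),\qquad \boldsymbol{\mathcal{T}}=\boldsymbol{I}_s\otimes\boldsymbol{M}+\delta t\,\boldsymbol{T}\otimes\boldsymbol{K}.$$ Then $\boldsymbol{\mathcal{M}}_{\text{BCSD}}$ is a mathematically optimal right preconditioner for $\boldsymbol{\mathcal{A}}$.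
   Context: $\otimes$ denotes the Kronecker product, $\boldsymbol{I}_k$ the $k\times k$ identity matrix, and $(\cdot)^H$ the conjugate transpose. Definition. Given $\boldsymbol{\mathcal{A}}\in\mathbb{R}^{n\times n}$ of rank $r$, a matrix $\boldsymbol{\mathcal{G}}$ is an $\epsilon$-accurate right-preconditioning operator for $\boldsymbol{\mathcal{A}}$ if there exists a nonsingular $\boldsymbol{\mathcal{X}}\in\mathbb{C}^{n\times n}$ such that $$\left\Vert \boldsymbol{\mathcal{X}}^{-1}(\boldsymbol{\mathcal{A}}\boldsymbol{\mathcal{G}})\boldsymbol{\mathcal{X}}-\begin{bmatrix}\boldsymbol{I}_r & \boldsymbol{0}\\ \boldsymbol{0}&\boldsymbol{0}\end{bmatrix}\right\Vert=\epsilon<1 .$$ It is mathematically optimal if $\epsilon=0$. A nonsingular matrix $\boldsymbol{\mathcal{M}}$ is called a mathematically optimal right preconditioner for $\boldsymbol{\mathcal{A}}$ if $\boldsymbol{\mathcal{G}}=\boldsymbol{\mathcal{M}}^{-1}$ is mathematically optimal in this sense; for nonsingular $\boldsymbol{\mathcal{A}}$ this is equivalent to $\boldsymbol{\mathcal{A}}\boldsymbol{\mathcal{M}}^{-1}=\boldsymbol{I}$. *)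

(* Defs.v *)
From HB Require Import structures.
From mathcomp Require Import all_boot all_order all_algebra.
From mathcomp Require Import sesquilinear spectral.
From mathcomp Require Import complex mxtens.
From mathcomp Require Import reals.

Set Implicit Arguments.
Unset Strict Implicit.
Unset Printing Implicit Defensive.

Import Order.TTheory GRing.Theory Num.Theory.
Import ComplexField.Normc.

Local Open Scope ring_scope.
Local Open Scope complex_scope.
Local Open Scope sesquilinear_scope.

Definition mxC (R : realType) (p q : nat) (A : 'M[R]_(p, q)) : 'M[R[i]]_(p, q) :=
  map_mx (real_complex R) A.

(* Submultiplicativity is not required, so that every usual matrix norm
   (spectral, Frobenius, induced, entrywise) is covered. *)
Record is_matrix_norm (R : realType) (n : nat) (N : 'M[R[i]]_n -> R) : Prop :=
  IsMatrixNorm {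
    mxnorm_ge0 : forall B, 0 <= N B;
    mxnorm_eq0 : forall B, N B = 0 -> B = 0;
    mxnormZ : forall (c : R[i]) B, N (c *: B) = normc c * N B;
    mxnormD : forall B D, N (B + D) <= N B + N D }.

(* [pid_mx r] is the block matrix [[I_r, 0], [0, 0]]. *)
Definition accurate_right_preconditioning (R : realType) (n : nat)
    (N : 'M[R[i]]_n -> R) (eps : R) (A : 'M[R]_n) (G : 'M[R[i]]_n) : Prop :=
  exists X : 'M[R[i]]_n,
    [/\ X \in unitmx,
        N (invmx X *m (mxC A *m G) *m X - pid_mx (\rank A)) = eps
      & eps < 1].

Definition optimal_right_preconditioning (R : realType) (n : nat)
    (N : 'M[R[i]]_n -> R) (A : 'M[R]_n) (G : 'M[R[i]]_n) : Prop :=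
  accurate_right_preconditioning N 0 A G.

Definition optimal_right_preconditioner (R : realType) (n : nat)
    (N : 'M[R[i]]_n -> R) (A : 'M[R]_n) (P : 'M[R[i]]_n) : Prop :=
  P \in unitmx /\ optimal_right_preconditioning N A (invmx P).

Definition upper_triangular (F : nzRingType) (n : nat) (T : 'M[F]_n) : Prop :=
  forall i j : 'I_n, (j < i)%N -> T i j = 0.

Definition complex_Schur_decomposition (R : realType) (n : nat)
    (A : 'M[R]_n) (U T : 'M[R[i]]_n) : Prop :=
  [/\ U \is unitarymx, upper_triangular T & mxC A = U *m T *m U^t*].

(* Generic in the ring: instantiated at the reals for the system matrix and at
   the complex numbers for the block upper triangular factor.  [*t] is the
   Kronecker product. *)
Definition stage_matrix (F : comNzRingType) (s m : nat) (dt : F)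
    (B : 'M[F]_s) (M K : 'M[F]_m) : 'M[F]_(s * m) :=
  1%:M *t M + dt *: (B *t K).

Definition M_BCSD (R : realType) (s m : nat) (dt : R)
    (M K : 'M[R]_m) (U T : 'M[R[i]]_s) : 'M[R[i]]_(s * m) :=
  (U *t 1%:M) *m stage_matrix dt%:C T (mxC M) (mxC K) *m (U^t* *t 1%:M).

(* Main.v *)
Require Import Defs.
From mathcomp Require Import all_boot all_order all_algebra.
From mathcomp Require Import complex reals.
From mathcomp Require Import spectral mxtens.

Import GRing.Theory.

Local Open Scope ring_scope.

(** Conjugation by [U *t 1%:M] acts only on the left Kronecker factors: it fixes the identity in
    front of [M] and turns [T] back into [A]. So [M_BCSD] is the system matrix itself, read over the
    complex numbers ([M_BCSD_eq]), and its inverse is an exact right inverse. *)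

Lemma map_stage_matrix (F G : comNzRingType) (f : {rmorphism F -> G})
    (s m : nat) (dt : F) (B : 'M[F]_s) (M K : 'M[F]_m) :
  map_mx f (stage_matrix dt B M K) =
  stage_matrix (f dt) (map_mx f B) (map_mx f M) (map_mx f K).
Proof. by rewrite /stage_matrix map_mxD map_mxZ !map_mxT map_mx1. Qed.

(** By the mixed-product rule, the [M] term becomes [(V *m W) *t M], where [VW = 1] applies, and the
    [K] term becomes [(V *m T *m W) *t K]. *)
Lemma stage_matrix_conj (F : comNzRingType) (s m : nat) (dt : F)
    (V T W : 'M[F]_s) (M K : 'M[F]_m) :
  V *m W = 1%:M ->
  (V *t 1%:M) *m stage_matrix dt T M K *m (W *t 1%:M) =
  stage_matrix dt (V *m T *m W) M K.
Proof.
move=> VW1; rewrite /stage_matrix mulmxDr mulmxDl -scalemxAr -scalemxAl.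
by rewrite !tensmx_mul !mulmx1 !mul1mx VW1.
Qed.

Lemma M_BCSD_eq (R : realType) (s m : nat) (dt : R) (M K : 'M[R]_m)
    (A : 'M[R]_s) (U T : 'M[R[i]]_s) :
  complex_Schur_decomposition A U T ->
  M_BCSD dt M K U T = mxC (stage_matrix dt A M K).
Proof.
case=> /unitarymxP UU1 _ A_UTU.
rewrite /M_BCSD stage_matrix_conj // -A_UTU.
by rewrite /mxC map_stage_matrix.
Qed.

Theorem proposition3p1 (R : realType) (s m : nat)
    (N : 'M[R[i]]_(s * m) -> R) (M K : 'M[R]_m) (A : 'M[R]_s) (dt : R)
    (U T : 'M[R[i]]_s) :
  (1 <= s)%N -> (1 <= m)%N ->
  is_matrix_norm N ->
  0 < dt ->
  stage_matrix dt A M K \in unitmx ->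
  complex_Schur_decomposition A U T ->
  optimal_right_preconditioner N (stage_matrix dt A M K) (M_BCSD dt M K U T).
Proof.
move=> _ _ [_ _ NZ _] _ stage_unit /M_BCSD_eq ->.
have stageC_unit : mxC (stage_matrix dt A M K) \in unitmx by rewrite map_unitmx.
(* The preconditioned matrix is already the identity, and full rank makes [pid_mx] the identity too,
   so no change of basis is required. *)
split=> //; exists 1%:M; split; [exact: unitmx1 | | exact: Num.Theory.ltr01].
rewrite mulmxV // invmx1 !mulmx1 mxrank_unit // pid_mx_1 subrr.
(* [N 0 = 0] follows from homogeneity, writing [0] as [0 *: 0]. *)
by rewrite -(scale0r 0) NZ ComplexField.Normc.normc0 mul0r.
Qed.
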